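(* Let $V$ be a finite-dimensional real vector space with inner product, $X$ a metric space, and $\sigma\colon V\to X$ a submetry such that $\{0\}$ is a fiber, with fat section $\Sigma\subset V$. Denote by $\pi_\Sigma$ the orthogonal projection onto $\Sigma$. Then: (a) For any $\sigma$-fiber $F\subset V$, \[\operatorname{conv}(F)\cap\Sigma=\pi_\Sigma(\operatorname{conv}(F))=\operatorname{conv}(F\cap\Sigma).\] In particular, $\pi_\Sigma(F)\subset\operatorname{conv}(F\cap\Sigma)$. (b) For every $\sigma$-saturated convex set $K\subset V$, $\pi_\Sigma(K)=K\cap\Sigma$. (c) The map $K\mapsto\pi_\Sigma(K)=K\cap\Sigma$ is a bijection between $\sigma$-saturated convex subsets of $V$ and $\sigma|_\Sigma$-saturated convex subsets of $\Sigma$.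
   Context: A submetry is a map $\sigma\colon Y\to X$ between metric spaces that maps closed balls to closed balls of the same radius, i.e. the image of the closed ball of radius $r$ around $y$ is the closed ball of radius $r$ around $\sigma(y)$. The vector space $V$ carries the Euclidean metric associated with its inner product. Given a submetry $\sigma\colon V\to X$ such that $\{0\}$ is a fiber, a linear subspace $\Sigma\subset V$ is called a fat section for $\sigma$ if the restriction $\sigma|_\Sigma\colon\Sigma\to X$ is a submetry. A subset of $V$ is $\sigma$-saturated if it is a union of fibers of $\sigma$ (equivalently, the inverse image under $\sigma$ of a subset of $X$); similarly for $\sigma|_\Sigma$-saturated subsets of $\Sigma$. $\operatorname{conv}(\cdot)$ denotes the convex hull. *)

(* Defs.v *)
(* MathComp-Analysis *)
From HB Require Import structures.
From mathcomp Require Import all_boot all_order all_algebra.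
From mathcomp Require Import all_classical all_reals all_analysis.
From mathcomp Require Import ring lra.

Set Implicit Arguments.
Unset Strict Implicit.
Unset Printing Implicit Defensive.

Import Order.TTheory GRing.Theory Num.Theory.

Local Open Scope classical_set_scope.
Local Open Scope ring_scope.

(* Alias of V carrying the metric induced by the inner product dot. *)
Definition euclidean {R : realType} {V : vectType R} (dot : {dot V for idfun}) :
  Type := V.

Section EuclideanMetric.
Context {R : realType} {V : vectType R} (dot : {dot V for idfun}).

HB.instance Definition _ := Choice.on (euclidean dot).

Definition edist (x y : euclidean dot) : R :=
  Num.sqrt (dot ((x : V) - y) ((x : V) - y)).

Lemma dot_ge0 (u : V) : 0 <= dot u u.
Proof.
have [->|u0] := eqVneq u 0; first by rewrite linear0r.
exact/ltW/neq0_dnorm_gt0.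
Qed.

Lemma dotC (u v : V) : dot u v = dot v u.
Proof. by rewrite hermC /= expr0 mul1r. Qed.

Lemma dotZl a (u v : V) : dot (a *: u) v = a * dot u v.
Proof. by rewrite linearZl_LR. Qed.

Lemma dotDD (u v : V) : dot (u + v) (u + v) = dot u u + dot u v *+ 2 + dot v v.
Proof. by rewrite linearDl /= !linearDr /= (dotC v u); ring. Qed.

Lemma dot_CauchySchwarz (u v : V) : dot u v ^+ 2 <= dot u u * dot v v.
Proof.
have [->|v0] := eqVneq v 0; first by rewrite (linear0r dot u) (linear0r dot 0) expr0n mulr0.
have vv0 : 0 < dot v v by exact: neq0_dnorm_gt0.
have := dot_ge0 (dot v v *: u + (- dot u v) *: v).
rewrite dotDD !dotZl !(dotC _ (_ *: _)) !dotZl (dotC v u) => h.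
have {h} : 0 <= dot v v * (dot u u * dot v v - dot u v ^+ 2).
  by apply: le_trans h _; rewrite le_eqVlt; apply/orP; left; apply/eqP; ring.
by rewrite pmulr_rge0// subr_ge0.
Qed.

Lemma edistxx x : edist x x = 0.
Proof. by rewrite /edist subrr linear0r sqrtr0. Qed.

Lemma edist_positivity x y : edist x y = 0 -> x = y.
Proof.
move=> /eqP; rewrite sqrtr_eq0 => xy0; apply/eqP; rewrite -subr_eq0.
by apply: contraTT xy0 => xy; rewrite -ltNge; exact: neq0_dnorm_gt0.
Qed.

Lemma edistC x y : edist x y = edist y x.
Proof. by rewrite /edist -opprB linearNl /= linearNr /= opprK. Qed.

Lemma edist_triangle y x z : edist x z <= edist x y + edist y z.
Proof.
rewrite /edist (_ : (x : V) - z = ((x : V) - y) + ((y : V) - z)); last first.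
  by rewrite addrA subrK.
move: ((x : V) - y) ((y : V) - z) => u v.
rewrite -(@ler_pXn2r _ 2)// ?nnegrE ?addr_ge0 ?sqrtr_ge0//.
rewrite sqrrD !sqr_sqrtr ?dot_ge0// dotDD lerD2r lerD2l lerMn2r /=.
rewrite -sqrtrM ?dot_ge0// (le_trans (ler_norm _))// -sqrtr_sqr.
exact/ler_wsqrtr/dot_CauchySchwarz.
Qed.

HB.instance Definition _ := @isMetric.Build R (euclidean dot) edist
  edistxx edist_positivity edistC edist_triangle.

End EuclideanMetric.

(* Not the library's closed_ball, which is the closure of the open ball and can
   be smaller in a general metric space. *)
Definition mclosed_ball {R : realType} {M : metricType R} (x : M) (r : R) :
  set M := [set y | mdist x y <= r].

(* The restriction of f to D is a submetry: D `&` mclosed_ball y r is the closed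
   ball of the metric subspace D. A submetry on the whole space is the case
   D = setT. *)
Definition submetry_on {R : realType} {Y X : metricType R} (D : set Y)
    (f : Y -> X) :=
  forall y r, D y -> 0 <= r ->
    f @` (D `&` mclosed_ball y r) = mclosed_ball (f y) r.

Definition submetry {R : realType} {Y X : metricType R} (f : Y -> X) :=
  submetry_on setT f.

(* The fibers of the restriction of f to D. *)
Definition fibers_on {Y X : Type} (D : set Y) (f : Y -> X) : set (set Y) :=
  [set F | exists x, F = D `&` f @^-1` [set x]].

Definition fibers {Y X : Type} (f : Y -> X) : set (set Y) := fibers_on setT f.

Definition saturated_on {Y X : Type} (D : set Y) (f : Y -> X) (K : set Y) :=
  exists2 FF : set (set Y), FF `<=` fibers_on D f & K = \bigcup_(F in FF) F.

Definition saturated {Y X : Type} (f : Y -> X) (K : set Y) :=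
  saturated_on setT f K.

Definition convex_hull {R : realType} {V : lmodType R} (A : set V) : set V :=
  smallest (@convex_set R V) A.

Section FatSection.
Context {R : realType} {V : vectType R} (dot : {dot V for idfun}).

Definition fat_section {X : metricType R} (sigma : euclidean dot -> X)
    (Sigma : {vspace V}) :=
  submetry_on ([set` Sigma] : set (euclidean dot)) sigma.

(* The projection onto Sigma along its dot-orthogonal complement; the two are
   complementary because dot is positive definite. *)
Definition orthoproj (Sigma : {vspace V}) : 'End(V) :=
  daddv_pi Sigma (orthov dot Sigma).

End FatSection.

(* Main.v *)
Require Import Defs.
From HB Require Import structures.
From mathcomp Require Import all_boot all_order all_algebra.
From mathcomp Require Import all_classical all_reals all_analysis.
From mathcomp Require Import ring lra.

(** Write a ~ b for sigma a = sigma b. The proof rests on support functions.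
    Since {0} is a fiber, every fiber lies on a sphere around 0, namely the one
    whose radius is the distance in X to sigma 0. Expanding |v - w|^2 then turns
    distances in X into maximal inner products: the maximum of <v', w'> over all
    v' ~ v and w' ~ w is determined by the distance from sigma v to sigma w and
    the norms of v and w. It can be attained with v' = v prescribed, and, when v
    lies in the fat section Sigma, with w' in Sigma as well, because the
    restriction of sigma to Sigma realizes the same distances. This is
    [fiber_support].

    For (a), let f be a point of a fiber F. If its projection pi f were outside
    the hull of F `&` Sigma, a vector v of Sigma would separate it strictly from
    F `&` Sigma. But <v, pi f> = <v, f>, and by [fiber_support] this is at most
    <v, w> for some w in F `&` Sigma. Hence pi F is contained in the hull of
    F `&` Sigma ([orthoproj_fiber_hull]), and the equalities in (a) and (b) are
    formal consequences.

    In (c), injectivity holds because every fiber meets Sigma. For surjectivity,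
    the saturation K of a saturated convex subset of Sigma has to be convex
    ([saturation_convex]). Let z be a convex combination of x and y in K and let
    z' ~ z be in Sigma. If z' is not in the hull of the traces on Sigma of the
    fibers of x and y, it is separated from them by some v in Sigma. Prescribing
    z instead of v in [fiber_support] gives v' ~ v with <z', v> <= <z, v'>. Now
    <z, v'> is a convex combination of <x, v'> and <y, v'>, each of which is
    smaller than <z', v>: a contradiction.

    A hull that is not closed cannot be separated strictly from its limit points,
    so it has to be known that the hull of a compact set has a point nearest to
    any given point. This follows from Caratheodory's theorem, which presents the
    hull as a continuous image of a compact set of weights and points. *)

Set Implicit Arguments.
Unset Strict Implicit.
Unset Printing Implicit Defensive.

Import Order.TTheory GRing.Theory Num.Theory VectorInternalTheory.
Import numFieldNormedType.Exports.

Local Open Scope classical_set_scope.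
Local Open Scope ring_scope.

(** * Convex sets and hulls *)

Lemma convex_setP (R : realType) (V : lmodType R) (A : set V) :
  convex_set A <-> forall x y (t : R), 0 <= t <= 1 -> A x -> A y ->
    A (t *: x + (1 - t) *: y).
Proof.
split=> [cA x y t /andP[t0 t1] Ax Ay|cA x y t /set_mem Ax /set_mem Ay].
  by have := cA x y (Itv01 t0 t1) (mem_set Ax) (mem_set Ay) => /set_mem.
by apply/mem_set/cA => //; rewrite ge0 le1.
Qed.

Lemma convex_hull_convex (R : realType) (V : lmodType R) (A : set V) :
  convex_set (convex_hull A).
Proof.
apply/convex_setP => x y t t01 Ax Ay K [cK AK].
by apply: (convex_setP K).1 => //; [exact: Ax|exact: Ay].
Qed.

Lemma sub_convex_hull (R : realType) (V : lmodType R) (A : set V) :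
  A `<=` convex_hull A.
Proof. exact: sub_smallest. Qed.

Lemma convex_hullS (R : realType) (V : lmodType R) (A B : set V) :
  A `<=` B -> convex_hull A `<=` convex_hull B.
Proof. by move=> AB x Ax K [cK BK]; apply: Ax; split=> //; exact: subset_trans BK. Qed.

Lemma convex_hull_min (R : realType) (V : lmodType R) (A K : set V) :
  convex_set K -> A `<=` K -> convex_hull A `<=` K.
Proof. by move=> cK AK x; apply. Qed.

Lemma convex_vspace (R : realType) (V : vectType R) (S : {vspace V}) :
  convex_set [set` S].
Proof. by apply/convex_setP => x y t _ xS yS; rewrite /= rpredD ?rpredZ. Qed.

Lemma convex_preimage (R : realType) (V W : vectType R) (f : 'Hom(V, W)) (K : set W) :
  convex_set K -> convex_set (f @^-1` K).
Proof.
move=> /convex_setP cK; apply/convex_setP => x y t t01 Kx Ky /=.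
by rewrite linearD !linearZ; exact: cK.
Qed.

(** * Caratheodory's theorem *)

Section ConvexCombinations.
Context {R : realType} {V : lmodType R}.
Implicit Types (A K : set V) (x y : V).

Definition convex_combination m A x :=
  exists a : 'I_m -> R, exists p : 'I_m -> V,
    [/\ forall i, 0 <= a i, \sum_i a i = 1, forall i, A (p i)
      & x = \sum_i a i *: p i].

Lemma convex_combination1 A x : A x -> convex_combination 1 A x.
Proof.
move=> Ax; exists (fun=> 1), (fun=> x); split=> //.
- by rewrite big_ord1.
- by rewrite big_ord1 scale1r.
Qed.

Lemma convex_combination_conv m k A x y (t : R) : 0 <= t <= 1 ->
  convex_combination m A x -> convex_combination k A y ->
  convex_combination (m + k) A (t *: x + (1 - t) *: y).
Proof.
move=> /andP[t0 t1] [a [p [a0 a1 Ap ->]]] [b [q [b0 b1 Aq ->]]].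
exists (fun i => match fintype.split i with
                 | inl j => t * a j | inr j => (1 - t) * b j end).
exists (fun i => match fintype.split i with
                 | inl j => p j | inr j => q j end).
have sl j : fintype.split (@lshift m k j) = inl j by rewrite (unsplitK (inl j)).
have sr j : fintype.split (@rshift m k j) = inr j by rewrite (unsplitK (inr j)).
split.
- by move=> i; case: splitP => j _; rewrite mulr_ge0// subr_ge0.
- rewrite big_split_ord /=.
  under eq_bigr do rewrite sl; under [X in _ + X]eq_bigr do rewrite sr.
  by rewrite -!mulr_sumr a1 b1; ring.
- by move=> i; case: splitP.
- rewrite big_split_ord /= !scaler_sumr.
  by congr (_ + _); apply: eq_bigr => i _; rewrite ?sl ?sr scalerA.
Qed.

(** Peel off the first point and rescale the remaining weights to sum to 1,
    unless they all vanish. *)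
Lemma convex_set_combination m A K x : A `<=` K -> convex_set K ->
  convex_combination m A x -> K x.
Proof.
move=> AK /convex_setP cK [a [p [a0 a1 Ap ->]]].
elim: m a p a0 a1 Ap => [a p _|m IH a p a0 a1 Ap].
  by rewrite big_ord0 => /eqP; rewrite eq_sym oner_eq0.
rewrite big_ord_recl; rewrite big_ord_recl in a1.
set b := fun i => a (lift ord0 i); set q := fun i => p (lift ord0 i).
have b0 i : 0 <= b i by exact: a0.
have sb0 : 0 <= \sum_i b i by exact: sumr_ge0.
have sbE : \sum_i b i = 1 - a ord0 by rewrite -a1 addrC addKr.
have [sb|sbn0] := eqVneq (\sum_i b i) 0.
  have bi0 i : b i = 0 by apply: (psumr_eq0P _ sb).
  rewrite [X in _ + X]big1 => [|i _]; last by rewrite -/(b i) bi0 scale0r.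
  move: a1; rewrite -/(b _) -[X in _ + X]/(\sum_i b i) sb addr0 => ->.
  by rewrite scale1r addr0; exact/AK.
have -> : \sum_(i < m) a (lift ord0 i) *: p (lift ord0 i)
    = (1 - a ord0) *: \sum_i (b i / (1 - a ord0)) *: q i.
  rewrite scaler_sumr; apply: eq_bigr => i _.
  by rewrite scalerA mulrCA divff ?mulr1// -sbE.
apply: cK; first by rewrite a0 -subr_ge0 -sbE.
- exact/AK.
- apply: IH => [i||i]; last exact: Ap.
  + by rewrite divr_ge0// -sbE.
  + by rewrite -mulr_suml -sbE divff.
Qed.

End ConvexCombinations.

Section Caratheodory.
Context {R : realType} {V : vectType R}.
Implicit Types (A : set V) (x : V).

(** The vectors (p i, 1) live in a space of dimension [dim V + 1], so a
    nontrivial linear relation holds between them. Its coefficients sum to 0 and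
    do not all vanish, hence one of them is positive. *)
Lemma affine_dependence m (p : 'I_m -> V) : (dim V + 1 < m)%N ->
  exists b : 'I_m -> R,
    [/\ exists i, 0 < b i, \sum_i b i = 0 & \sum_i b i *: p i = 0].
Proof.
move=> Vm.
pose M : 'M[R]_(m, dim V + 1) := \matrix_i row_mx (v2r (p i)) 1.
have : kermx M != 0.
  rewrite kermx_eq0 /row_free neq_ltn (leq_ltn_trans (rank_leq_col _))//.
move=> /rowV0Pn[b /sub_kermxP bM b0].
have bE : \sum_i b 0 i *: row i M = 0 by rewrite -mulmx_sum_row.
have bME : row_mx (\sum_i b 0 i *: v2r (p i)) (\sum_i b 0 i *: (1 : 'rV[R]_1)) = 0.
  rewrite -bE -[RHS]hsubmxK; congr row_mx; rewrite linear_sum;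
    apply: eq_bigr => i _; rewrite linearZ /= rowK ?row_mxKl ?row_mxKr//.
have := bME; rewrite -[RHS]row_mx0 => /eq_row_mx[bp b1].
have sb : \sum_i b 0 i = 0.
  move/rowP: b1 => /(_ 0); rewrite summxE mxE => b1.
  by rewrite -[RHS]b1; apply: eq_bigr => i _; rewrite !mxE mulr1.
exists (b 0); split=> //; last first.
  by apply: v2r_inj; rewrite linear0 -bp linear_sum;
     apply: eq_bigr => i _; rewrite linearZ.
apply: contrapT => nb; move/eqP: b0; apply; apply/rowP => i.
rewrite mxE; apply/eqP; rewrite -oppr_eq0.
apply/eqP; apply: (@psumr_eq0P _ _ xpredT (fun i => - b 0 i)) => // [j _|].
  by rewrite oppr_ge0 leNgt; apply/negP => bj; apply: nb; exists j.
by rewrite sumrN sb oppr0.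
Qed.

(** Subtracting a multiple of an affine dependence changes neither the point nor
    the total weight. The largest multiple that keeps the weights nonnegative
    makes one of them vanish. *)
Lemma convex_combination_reduce m A x : (dim V + 1 < m.+1)%N ->
  convex_combination m.+1 A x -> convex_combination m A x.
Proof.
move=> Vm [a [p [a0 a1 Ap ->]]].
have [b [[i1 bi1] b1 bp]] := affine_dependence p Vm.
pose i0 := [arg min_(i < i1 | 0 < b i) (a i / b i)]%O.
have [bi0 mini0] : 0 < b i0 /\ forall j, 0 < b j -> a i0 / b i0 <= a j / b j.
  by rewrite /i0; case: arg_minP => // i ? ?; split.
pose t := a i0 / b i0.
have t0 : 0 <= t by rewrite divr_ge0// ltW.
pose c i := a i - t * b i.
have c0 i : 0 <= c i.
  rewrite subr_ge0; have [bi|bi] := ltP 0 (b i).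
    by rewrite -ler_pdivlMr// mini0.
  by rewrite (le_trans _ (a0 i))// mulr_ge0_le0.
have ci0 : c i0 = 0 by rewrite /c /t divfK ?subrr// gt_eqF.
have c1 : \sum_i c i = 1 by rewrite sumrB a1 -mulr_sumr b1 mulr0 subr0.
have cp : \sum_i c i *: p i = \sum_i a i *: p i.
  under eq_bigr do rewrite scalerBl -scalerA.
  by rewrite sumrB -scaler_sumr bp scaler0 subr0.
exists (c \o lift i0), (p \o lift i0); split=> //=.
- by rewrite -c1 (bigD1_ord i0)//= ci0 add0r.
- by rewrite -cp (bigD1_ord i0)//= ci0 scale0r add0r.
Qed.

(** Points of weight 0 are added first, so that removing one point at a time
    ends at exactly [(dim V).+1] of them, however small [m] is. *)
Lemma caratheodory m A x :
  convex_combination m A x -> convex_combination (dim V).+1 A x.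
Proof.
move=> Ax; have [p Ap] : A !=set0.
  case: m Ax => [[a [p [_]]]|m [a [p [_ _ Ap _]]]]; last by exists (p ord0).
  by rewrite big_ord0 => /eqP; rewrite eq_sym oner_eq0.
have combp k : convex_combination k.+1 A p.
  exists (fun i => (i == ord0)%:R), (fun=> p); split=> //.
  - by rewrite (bigD1 ord0)//= big1 ?addr0// => i /negPf->.
  - by rewrite -scaler_suml (bigD1 ord0)//= big1 ?addr0 ?scale1r// => i /negPf->.
have : convex_combination (m + (dim V).+1) A x.
  have := @convex_combination_conv _ _ _ _ _ _ _ 1 _ Ax (combp (dim V)).
  by rewrite ler01 lexx subrr scale0r scale1r addr0; apply.
elim: m {Ax} => // m IH Ax; apply: IH; apply: convex_combination_reduce => //.
by rewrite addn1 ltnS leq_addl.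
Qed.

Lemma convex_hullE A : convex_hull A = convex_combination (dim V).+1 A.
Proof.
apply/seteqP; split=> x Ax.
- apply: Ax; split=> [|y /convex_combination1/caratheodory//].
  apply/convex_setP => y z t t01 Ay Az.
  exact: (caratheodory (convex_combination_conv t01 Ay Az)).
- by move=> K [cK AK]; exact: convex_set_combination AK cK Ax.
Qed.

End Caratheodory.

(** * Compactness and strict separation *)

Section Dot.
Context {R : realType} {V : vectType R} (dot : {dot V for idfun}).
Implicit Types (u v w p q : V) (A : set V).

Definition sqdist u v := dot (u - v) (u - v).

Lemma sqdistE u v : sqdist u v = dot u u - dot u v *+ 2 + dot v v.
Proof. by rewrite /sqdist dotDD linearNr linearNl /= linearNr opprK mulNrn. Qed.

Lemma dot_eq0 u : (dot u u == 0) = (u == 0).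
Proof.
have [->|u0] := eqVneq u 0; first by rewrite linear0r eqxx.
by rewrite gt_eqF// neq0_dnorm_gt0.
Qed.

Lemma dotZZ (a : R) u : dot (a *: u) (a *: u) = a ^+ 2 * dot u u.
Proof. by rewrite dotZl dotC dotZl mulrA -expr2. Qed.

Let coordc i : continuous (fun x : 'rV[R]_(dim V) => x ord0 i).
Proof. exact: coord_continuous. Qed.

Lemma continuous_dot w : continuous (fun x : 'rV[R]_(dim V) => dot w (r2v x)).
Proof.
have -> : (fun x : 'rV[R]_(dim V) => dot w (r2v x))
    = fun x => \sum_i x ord0 i * dot w (r2v (delta_mx 0 i)).
  apply/funext => x; rewrite {1}[x]row_sum_delta linear_sum linear_sumr.
  by apply: eq_bigr => i _; rewrite linearZ /= dotC dotZl dotC.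
apply: continuous_big => [|i _]; first exact: add_continuous.
by move=> x; apply: continuousM; [exact: coordc|exact: cst_continuous].
Qed.

Lemma continuous_sqdist p :
  continuous (fun x : 'rV[R]_(dim V) => sqdist (r2v x) p).
Proof.
have -> : (fun x : 'rV[R]_(dim V) => sqdist (r2v x) p) = fun x =>
    \sum_i x ord0 i * dot (r2v (delta_mx 0 i)) (r2v x)
    - dot p (r2v x) *+ 2 + dot p p.
  apply/funext => x; rewrite sqdistE (dotC _ p); congr (_ - _ + _).
  rewrite {1}[x]row_sum_delta linear_sum linear_sumlz.
  by apply: eq_bigr => i _; rewrite linearZ /= dotZl.
have cN : continuous (fun x : 'rV[R]_(dim V) => - (dot p (r2v x) *+ 2)).
  by move=> x; exact: (@cvgN _ R^o _ _ _ _ _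
    (@cvgMn _ R^o _ _ _ _ 2 _ (@continuous_dot p x))).
suff cQ : continuous (fun x : 'rV[R]_(dim V) =>
    \sum_i x ord0 i * dot (r2v (delta_mx 0 i)) (r2v x)).
  by move=> x; exact: (@cvgD _ R^o _ _ _ _ _ _ _
    (@cvgD _ R^o _ _ _ _ _ _ _ (cQ x) (cN x)) (cvg_cst _)).
apply: continuous_big => [|i _]; first exact: add_continuous.
by move=> y; apply: continuousM; [exact: coordc|exact: continuous_dot].
Qed.

(** The quadratic form attains a positive minimum on the unit sphere of the
    coordinate space. This is what makes sets that are bounded for [dot] bounded
    in coordinates. *)
Lemma dot_dominates_norm :
  exists2 m : R, 0 < m & forall u, m * `|v2r u| ^+ 2 <= dot u u.
Proof.
pose S := [set x : 'rV[R]_(dim V) | `|x| = 1].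
have cS : compact S.
  apply: bounded_closed_compact.
    by exists 1; split=> // r r1 x /= ->; exact: ltW.
  apply: (@preimage_closed _ _ (fun x : 'rV[R]_(dim V) => `|x|) [set 1]).
    by move=> x _; exact: norm_continuous.
  exact: closed_eq.
have toS u : u != 0 -> S (`|v2r u|^-1 *: v2r u).
  move=> u0; rewrite /S /= normrZ normrV ?unitfE ?normr_eq0 ?(can2_eq v2rK r2vK) ?linear0//.
  by rewrite normr_id mulVf// normr_eq0 (can2_eq v2rK r2vK) linear0.
have [S0|S0] := eqVneq S set0.
  exists 1 => // u; have [->|/toS] := eqVneq u 0; last by rewrite S0.
  by rewrite linear0 normr0 expr0n mulr0 linear0r.
have [c cinS minc] : exists2 c, c \in S &
    forall x, x \in S -> sqdist (r2v c) 0 <= sqdist (r2v x) 0.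
  apply: compact_EVT_min => //; first exact/set0P.
  exact/continuous_subspaceT/continuous_sqdist.
exists (sqdist (r2v c) 0).
  rewrite /sqdist subr0 neq0_dnorm_gt0// (can2_eq r2vK v2rK) linear0.
  rewrite -normr_eq0; move/set_mem : cinS => ->; exact: oner_neq0.
move=> u; have [->|u0] := eqVneq u 0.
  by rewrite linear0 normr0 expr0n mulr0 linear0r.
have := minc _ (mem_set (toS _ u0)).
rewrite {2}/sqdist subr0 linearZ /= v2rK dotZZ exprVn mulrC ler_pdivlMr//.
by rewrite exprn_gt0// normr_gt0 (can2_eq v2rK r2vK) linear0.
Qed.

(** All norms on a finite-dimensional space being equivalent, compactness can be
    read off in the coordinates given by [v2r]. *)
Definition vcompact A := compact (v2r @` A).

(** Heine-Borel, with closedness and boundedness both measured by [dot]. *)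
Lemma vcompact_closed_bounded A (r : R) :
  (forall a, A a -> dot a a <= r) ->
  (forall p, (forall e : R, 0 < e -> exists2 a, A a & sqdist a p < e) -> A p) ->
  vcompact A.
Proof.
move=> Ar clA; apply: bounded_closed_compact.
  have [m m0 mdot] := dot_dominates_norm.
  exists (1 + r / m); split; first exact: num_real.
  move=> M Mr _ [a Aa <-].
  have r0 : 0 <= r / m.
    by rewrite divr_ge0 ?(ltW m0)// (le_trans (dot_ge0 dot a) (Ar _ Aa)).
  have : `|v2r a| ^+ 2 <= r / m.
    by rewrite ler_pdivlMr// mulrC (le_trans (mdot a))// Ar.
  move: Mr r0; set k := r / m; set s := `|v2r a| => Mk k0 sk.
  rewrite /= leNgt; apply/negP => Ms.
  have {}Ms : M < s := Ms; nra.
move=> x clx; exists (r2v x); last by rewrite r2vK.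
apply: clA => e e0.
have : nbhs x [set y | sqdist (r2v y) (r2v x) < e].
  apply: (@continuous_sqdist (r2v x) x [set z | z < e]).
  apply: open_nbhs_nbhs; split; first exact: open_lt.
  by rewrite /= {1}/sqdist subrr linear0r.
by move=> /clx[_ [[a Aa <-] /=]]; rewrite v2rK; exists a.
Qed.

Lemma vcompactU A B : vcompact A -> vcompact B -> vcompact (A `|` B).
Proof. by rewrite /vcompact image_setU; exact: compactU. Qed.

(** By Caratheodory the hull is the image, under the continuous map [g] that
    sends weights and points to their combination, of a set [Q] that is compact
    by Tychonoff's theorem. *)
Lemma nearest_point_hull A p : vcompact A -> A !=set0 ->
  exists2 q, convex_hull A q &
    forall h, convex_hull A h -> sqdist q p <= sqdist h p.
Proof.
move=> cA [a0 Aa0]; pose N := (dim V).+1.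
pose T := (fun _ : 'I_N => (R * 'rV[R]_(dim V))%type : topologicalType).
pose P : set (prod_topology T) := [set f |
  forall i, (`[0, 1]%classic `*` (v2r @` A)) (f i)].
have cP : compact P.
  apply: (@tychonoff _ T (fun=> `[0, 1]%classic `*` (v2r @` A))) => i.
  by apply: compact_setX => //; exact: segment_compact.
have cproj i : continuous (fun f : prod_topology T => f i).
  exact: (@proj_continuous _ T i).
have c1 i : continuous (fun f : prod_topology T => (f i).1).
  by move=> f; apply: (@cvg_comp _ _ _ (fun f => f i) fst); [exact: cproj|exact: cvg_fst].
have c2 i : continuous (fun f : prod_topology T => (f i).2).
  by move=> f; apply: (@cvg_comp _ _ _ (fun f => f i) snd); [exact: cproj|exact: cvg_snd].
pose Q := P `&` [set f | \sum_i (f i).1 = 1].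
have cQ : compact Q.
  apply: compact_closedI => //.
  apply: (@preimage_closed _ _ (fun f : prod_topology T => \sum_i (f i).1) [set 1]).
    move=> f _; apply: continuous_big => [|i _]; first exact: add_continuous.
    exact: c1.
  exact: closed_eq.
pose g (f : prod_topology T) := \sum_i (f i).1 *: (f i).2.
have cg : continuous g.
  apply: continuous_big => [|i _]; first exact: add_continuous.
  by move=> f; exact: cvgZ (c1 i f) (c2 i f).
have hullQ h : convex_hull A h <-> exists2 f, Q f & r2v (g f) = h.
  rewrite convex_hullE; split.
    move=> [a [y [a0' a1 Ay ->]]].
    exists (fun i => (a i, v2r (y i))); last first.
      by rewrite /g linear_sum; apply: eq_bigr => i _; rewrite linearZ /= v2rK.
    split=> //= i; split=> /=; last by exists (y i).
    rewrite in_itv /= a0' /= -a1 (bigD1 i)//= lerDl; apply: sumr_ge0 => //.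
  move=> [f [Pf f1] <-].
  exists (fun i => (f i).1), (fun i => r2v (f i).2); split=> //.
  - by move=> i; have [] := Pf i; rewrite /= in_itv /= => /andP[].
  - by move=> i; have [_ /= [a Aa <-]] := Pf i; rewrite v2rK.
  - by rewrite /g linear_sum; apply: eq_bigr => i _; rewrite linearZ.
have [f] : exists2 f, f \in Q & forall h, h \in Q ->
    sqdist (r2v (g f)) p <= sqdist (r2v (g h)) p.
  apply: compact_EVT_min => //.
    have /hullQ[f Qf _] : convex_hull A a0 by move=> K [_]; exact.
    by exists f.
  apply: continuous_subspaceT => f.
  exact: (@continuous_comp _ _ _ g (fun x => sqdist (r2v x) p) f
    (cg f) (@continuous_sqdist p (g f))).
move=> /set_mem Qf minf; exists (r2v (g f)); first by apply/hullQ; exists f.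
by move=> h /hullQ[k Qk <-]; apply: minf; exact: mem_set.
Qed.

(** The point [q] of the hull nearest to [p] does it: were the inner product of
    [p - q] and [a - q] positive, a small step from [q] towards [a] would come
    closer to [p]. That [q] is in the hull matters to the users: it puts [p - q]
    in every subspace that contains [p] and [A]. *)
Lemma separation A p : vcompact A -> A !=set0 -> ~ convex_hull A p ->
  exists2 q, convex_hull A q & forall a, A a -> dot (p - q) a < dot (p - q) p.
Proof.
move=> cA A0 Ap; have [q hq qmin] := nearest_point_hull p cA A0.
exists q => // a /sub_convex_hull ha; pose v := p - q.
have v0 : 0 < dot v v.
  by rewrite neq0_dnorm_gt0// subr_eq0; apply: contra_notN Ap => /eqP->.
suff : dot v (a - q) <= 0.
  move: v0; rewrite {2}/v !linearBr /= -/v; lra.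
rewrite leNgt; apply/negP => c0; set c := dot v (a - q) in c0.
pose D := dot (a - q) (a - q); have D0 : 0 <= D by exact: dot_ge0.
pose t := c / (c + D); have cD : 0 < c + D by lra.
have t01 : 0 <= t <= 1.
  by rewrite divr_ge0 ?(ltW c0) ?(ltW cD)//= ler_pdivrMr// mul1r lerDl.
have /convex_setP/(_ _ _ _ t01 ha hq)/qmin := @convex_hull_convex R V A.
(* The squared distance to p is |v|^2 - 2 t c + t^2 D at parameter t, which is
   less than |v|^2 at t = c / (c + D) because t D <= c there. *)
have -> : sqdist (t *: a + (1 - t) *: q) p = dot v v - t * c *+ 2 + t ^+ 2 * D.
  have -> : sqdist (t *: a + (1 - t) *: q) p = sqdist (t *: (a - q)) v.
    rewrite /sqdist (_ : t *: a + (1 - t) *: q - p = t *: (a - q) - v)//.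
    by rewrite /v opprB scalerBl scale1r scalerBr [q - _]addrC !addrA.
  rewrite sqdistE dotZZ dotZl (dotC dot (a - q)) -/c -/D; ring.
have -> : sqdist q p = dot v v by rewrite /sqdist -opprB linearNl /= linearNr opprK.
have tt : t * (c + D) = c by rewrite divfK// gt_eqF.
have t0 : 0 < t by rewrite divr_gt0.
nra.
Qed.

End Dot.

(** * Orthogonal projection *)

Section OrthogonalProjection.
Context {R : realType} {V : vectType R} (dot : {dot V for idfun}).
Implicit Types (u v w : V) (S : {vspace V}).

Lemma capv_orthov S : (S :&: orthov dot S = 0)%VS.
Proof.
apply/eqP; rewrite -subv0; apply/subvP => u /memv_capP[uS /mem_orthovP/(_ u uS)].
by move/eqP; rewrite dot_eq0 memv0.
Qed.

Definition dot_basis S u : 'rV[R]_(\dim S) := \row_i dot u (vbasis S)`_i.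

Fact dot_basis_is_linear S : linear (dot_basis S).
Proof. by move=> a u v; apply/rowP => i; rewrite !mxE linearDl /= dotZl. Qed.

HB.instance Definition _ S :=
  GRing.isLinear.Build R V 'rV[R]_(\dim S) _ (dot_basis S) (dot_basis_is_linear S).

Lemma dot_basis_eq0 S u : dot_basis S u = 0 -> u \in orthov dot S.
Proof.
move=> /rowP u0; apply/mem_orthovP => v /coord_vbasis->.
by rewrite linear_sumr big1// => i _; have := u0 i;
   rewrite !mxE linearZr_LR /= => ->; rewrite mulr0.
Qed.

(** Inner products with a basis of S are coordinates that are injective on S,
    because S meets its orthogonal only in 0; by dimension they map S onto the
    whole coordinate space. So every w has the same coordinates as some s in S,
    and then [w - s] is orthogonal to S. *)
Lemma addv_orthov S : (S + orthov dot S = fullv)%VS.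
Proof.
pose f := linfun (dot_basis S).
have fS : (f @: S = fullv)%VS.
  apply/eqP; rewrite eqEdim subvf /= dimvf /dim /= mul1n.
  rewrite -[leqLHS](limg_ker_dim f S) (_ : (S :&: lker f = 0)%VS) ?dimv0//.
  apply/eqP; rewrite -subv0 -(capv_orthov S); apply: capvS => //.
  by apply/subvP => u; rewrite memv_ker lfunE /= => /eqP/dot_basis_eq0.
apply/eqP; rewrite eqEsubv subvf /=; apply/subvP => w _.
have /memv_imgP[s sS fws] : f w \in (f @: S)%VS by rewrite fS memvf.
rewrite -(subrKC s w) memv_add//; apply: dot_basis_eq0.
by move: fws; rewrite !lfunE linearB /= => ->; rewrite subrr.
Qed.

Lemma orthoproj_in S u : orthoproj dot S u \in S.
Proof. exact: memv_pi. Qed.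

Lemma orthoproj_id S u : u \in S -> orthoproj dot S u = u.
Proof. exact/daddv_pi_id/capv_orthov. Qed.

Lemma dot_orthoproj S u v : v \in S -> dot v (orthoproj dot S u) = dot v u.
Proof.
move=> vS; have uS : u \in (S + orthov dot S)%VS by rewrite addv_orthov memvf.
rewrite -{2}(daddv_pi_add (capv_orthov S) uS) linearDr /= dotC.
have /mem_orthovP/(_ v vS) := memv_pi (orthov dot S) S u.
by rewrite (dotC _ v) => ->; rewrite addr0 dotC.
Qed.

(** Pythagoras: no point of S is nearer to p than the projection of p. *)
Lemma vspace_closed S p :
  (forall e : R, 0 < e -> exists2 a, a \in S & sqdist dot a p < e) -> p \in S.
Proof.
move=> Sp; set q := orthoproj dot S p.
have qS : q \in S by exact: orthoproj_in.
suff : p - q = 0 by move/eqP; rewrite subr_eq0 => /eqP->.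
have [//|pq0] := eqVneq (p - q) 0.
have /Sp[a aS] : 0 < dot (p - q) (p - q) by rewrite neq0_dnorm_gt0.
rewrite ltNge => /negP[].
have -> : sqdist dot a p = dot (a - q) (a - q) + dot (p - q) (p - q).
  have -> : sqdist dot a p = sqdist dot (a - q) (p - q).
    by rewrite /sqdist opprB addrA subrK.
  rewrite sqdistE (linearBr dot (a - q) p q) /= (dot_orthoproj p) ?rpredB//.
  by rewrite subrr mul0rn subr0.
by rewrite lerDr dot_ge0.
Qed.

End OrthogonalProjection.

(** * Fibers of submetries *)

Section Submetry.
Context {R : realType} {V : vectType R} {dot : {dot V for idfun}}.
Context {X : metricType R} {sigma : euclidean dot -> X}.
Hypothesis sigma_submetry : submetry sigma.
Hypothesis fiber0 : fibers sigma [set (0 : V)].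

(** The ball around y of radius [mdist (sigma y) x] maps onto a ball that
    contains x. *)
Lemma submetry_on_lift (D : set (euclidean dot)) (y : V) x :
  submetry_on D sigma -> D y ->
  exists2 z : V, D z /\ sigma z = x & sqdist dot y z <= mdist (sigma y) x ^+ 2.
Proof.
move=> sD Dy; have := sD y (mdist (sigma y) x) Dy (mdist_ge0 _ _).
move=> /seteqP[_ /(_ x (lexx _))[z [Dz /= yz] zx]].
exists z => //; rewrite -[sqdist _ _ _]sqr_sqrtr ?dot_ge0//.
by rewrite ler_pXn2r ?nnegrE ?sqrtr_ge0 ?mdist_ge0.
Qed.

Lemma submetry_lipschitz (y z : V) : mdist (sigma y) (sigma z) ^+ 2 <= sqdist dot y z.
Proof.
have /seteqP[/(_ (sigma z)) + _] := sigma_submetry (y := y) I (sqrtr_ge0 (sqdist dot y z)).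
move=> /(_ (ex_intro2 _ _ z (conj I (lexx _)) erefl)) h.
rewrite -[leRHS]sqr_sqrtr ?dot_ge0// ler_pXn2r ?nnegrE ?sqrtr_ge0 ?mdist_ge0//.
Qed.

Lemma fiber0E (z : V) : sigma z = sigma 0 -> z = 0.
Proof.
have [x Fx] := fiber0.
have s0 : sigma 0 = x by have [] : (setT `&` sigma @^-1` [set x]) (0 : V) by rewrite -Fx.
move=> z0; suff : [set (0 : V)] z by [].
by rewrite Fx; split => //=; rewrite z0.
Qed.

(** The norm of u is the distance from [sigma u] to [sigma 0]: that distance is
    realized from u by a point over [sigma 0], which can only be 0. *)
Lemma dot_fiber (y z : V) : sigma y = sigma z -> dot y y = dot z z.
Proof.
have norm (u : V) : dot u u = mdist (sigma u) (sigma 0) ^+ 2.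
  apply/le_anti/andP; split; last first.
    by rewrite (le_trans (submetry_lipschitz _ _))// /sqdist subr0.
  have [w [_ /fiber0E->]] := @submetry_on_lift setT u (sigma 0) sigma_submetry I.
  by rewrite /sqdist subr0.
by move=> yz; rewrite !norm yz.
Qed.

(** Take for [z'] a point of the fiber of z nearest to v among those in D. As norms
    are constant on fibers, minimizing the distance between two fibers amounts to
    maximizing the inner product. Used with D the whole space and with D the fat
    section. *)
Lemma fiber_support (D : set (euclidean dot)) (v z : V) :
  submetry_on D sigma -> D v ->
  exists2 z' : V, D z' /\ sigma z' = sigma z &
    forall v' w, sigma v' = sigma v -> sigma w = sigma z -> dot v' w <= dot v z'.
Proof.
move=> sD Dv; have [z' [Dz' zz'] vz'] := submetry_on_lift (sigma z) sD Dv.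
exists z' => // v' w v'v wz.
have := le_trans vz' (submetry_lipschitz v z).
have : sqdist dot v z' <= sqdist dot v' w.
  by rewrite (le_trans vz')// -v'v -wz submetry_lipschitz.
rewrite !sqdistE (dot_fiber v'v) (dot_fiber wz) (dot_fiber zz'); lra.
Qed.

(** Boundedness holds because fibers lie on spheres, closedness because sigma is
    1-Lipschitz and subspaces are closed. *)
Lemma vcompact_fiber_section (S : {vspace V}) x :
  vcompact [set y : V | y \in S /\ sigma y = x].
Proof.
have [[z zx]|nx] := pselect (exists z : V, sigma z = x); last first.
  suff -> : [set y : V | y \in S /\ sigma y = x] = set0.
    by rewrite /vcompact image_set0; exact: compact0.
  by apply/seteqP; split=> // y [_ yx]; apply: nx; exists y.
apply: (@vcompact_closed_bounded _ _ dot _ (dot z z)).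
  by move=> a [_ ax]; rewrite (@dot_fiber a z) ?ax.
move=> p clp; split.
  by apply: (@vspace_closed _ _ dot) => e /clp[a []]; exists a.
apply: contrapT => px.
have : 0 < mdist x (sigma p) ^+ 2.
  by rewrite exprn_gt0// mdist_gt0; exact/eqP/nesym.
move=> /clp[a [_ ax]]; apply/negP; rewrite -leNgt -ax; exact: submetry_lipschitz.
Qed.

End Submetry.

(** * Convexity and fat sections *)

Lemma saturated_onP {Y X : Type} (D : set Y) (f : Y -> X) (K : set Y) :
  saturated_on D f K <->
  K `<=` D /\ forall y z, K y -> D z -> f z = f y -> K z.
Proof.
split=> [[FF FFD ->]|[KD Kf]].
  split=> [y [F /FFD[x ->] []]//|y z [F FF_F Fy] Dz zy].
  have [x Fx] := FFD _ FF_F; exists F => //.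
  by move: Fy; rewrite Fx => -[_ /= yx]; split=> //=; rewrite zy.
exists [set F | exists2 y, K y & F = D `&` f @^-1` [set f y]].
  by move=> _ [y _ ->]; exists (f y).
apply/seteqP; split=> [y Ky|z [_ [y Ky ->] [Dz zy]]]; last exact: Kf zy.
by exists (D `&` f @^-1` [set f y]); [exists y|split=> //; exact: KD].
Qed.

Section FatSection.
Context {R : realType} {V : vectType R} {dot : {dot V for idfun}}.
Context {X : metricType R} {sigma : euclidean dot -> X} {S : {vspace V}}.
Hypothesis sigma_submetry : submetry sigma.
Hypothesis fiber0 : fibers sigma [set (0 : V)].
Hypothesis S_fat : fat_section sigma S.

Let slice x := [set y : V | y \in S /\ sigma y = x].

Let support (v z : V) : v \in S ->
  exists2 z' : V, slice (sigma z) z' &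
    forall v' w, sigma v' = sigma v -> sigma w = sigma z -> dot v' w <= dot v z'.
Proof. exact: (fiber_support sigma_submetry fiber0 z S_fat). Qed.

Let slice_nonempty z : slice (sigma z) !=set0.
Proof. by have [z' z'z _] := support z (mem0v S); exists z'. Qed.

Let slice_hull_sub x : convex_hull (slice x) `<=` [set` S].
Proof. by apply: convex_hull_min; [exact: convex_vspace|move=> y []]. Qed.

(** A vector v of S that separates the projection of f from the trace on S of the
    fiber of f would make [dot v f] greater than [dot v w] for all w in that
    trace, against [fiber_support]. *)
Lemma orthoproj_fiber_hull (f : V) :
  convex_hull [set y : V | y \in S /\ sigma y = sigma f] (orthoproj dot S f).
Proof.
apply: contrapT => nf.
have cf : vcompact (slice (sigma f)) by exact: vcompact_fiber_section.
have [q hq sep] := separation dot cf (slice_nonempty f) nf.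
have vS : orthoproj dot S f - q \in S.
  by rewrite rpredB ?orthoproj_in//; exact: slice_hull_sub hq.
have [z' /sep + /(_ _ f erefl erefl)] := support f vS.
by rewrite (dot_orthoproj dot f vS) ltNge => /negP.
Qed.

Lemma orthoproj_saturated_convex (K : set V) :
  saturated sigma K -> convex_set K -> orthoproj dot S @` K = K `&` [set` S].
Proof.
move=> /saturated_onP[_ Kf] cK; apply/seteqP; split=> [_ [y Ky <-]|y [Ky yS]].
  split; last exact: orthoproj_in.
  apply: (convex_hull_min cK _ (@orthoproj_fiber_hull y)).
  by move=> z [_ zy]; exact: Kf Ky _ zy.
by exists y => //; rewrite orthoproj_id.
Qed.

(** [fiber_support] is used with v prescribed, to compare points of the fibers of
    x and y with points of S, and with z prescribed, to replace v by the point
    [v'] of its fiber for which linearity in z applies. *)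
Lemma saturation_convex (L : set V) : saturated_on [set` S] sigma L ->
  convex_set L -> convex_set (sigma @^-1` (sigma @` L) : set V).
Proof.
move=> /saturated_onP[LS Lf] cL; apply/convex_setP => x y t /andP[t0 t1].
move=> [lx Lx lxE] [ly Ly lyE]; set z := t *: x + _.
pose A := slice (sigma x) `|` slice (sigma y).
have AL : A `<=` L.
  move=> u [[uS ux]|[uS uy]].
    by apply: (Lf lx) => //; rewrite ux lxE.
  by apply: (Lf ly) => //; rewrite uy lyE.
have [z' [z'S z'z] _] := support z (mem0v S).
exists z' => //; apply: (convex_hull_min cL AL); apply: contrapT => nz'.
have cA : vcompact A by apply: vcompactU; exact: vcompact_fiber_section.
have A0 : A !=set0 by have [u] := slice_nonempty x; exists u; left.
have [q hq sep] := separation dot cA A0 nz'.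
set v := z' - q in sep.
have vS : v \in S by rewrite rpredB//; exact/LS/(convex_hull_min cL AL).
have [v' [_ v'v] zv'] :=
  fiber_support sigma_submetry fiber0 v sigma_submetry (I : setT z).
have lt_support (w : V) : A `&` slice (sigma w) = slice (sigma w) ->
    dot w v' < dot v z'.
  move=> Aw; have [a aw /(_ v' w v'v erefl)] := support w vS.
  rewrite dotC; move/le_lt_trans; apply; apply: sep.
  by have [] : (A `&` slice (sigma w)) a by rewrite Aw.
have vx : dot x v' < dot v z'.
  by apply: lt_support; apply/setIidr => u; left.
have vy : dot y v' < dot v z'.
  by apply: lt_support; apply/setIidr => u; right.
have := zv' z' v z'z erefl.
rewrite (dotC dot z') /z (linearDl dot v' (t *: x)) /= !dotZl.
move: vx vy; move: (dot x v') (dot y v') (dot v z') => a b c ac bc.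
rewrite leNgt => /negP[].
(* Strictness survives because t and 1 - t are not both small. *)
have [t12|t12] := ltP t (1 / 2); nra.
Qed.

End FatSection.

Theorem theorem3 (R : realType) (V : vectType R) (dot : {dot V for idfun})
    (X : metricType R) (sigma : euclidean dot -> X) (Sigma : {vspace V})
    (sigma_submetry : submetry sigma)
    (fiber0 : fibers sigma [set (0 : V)])
    (Sigma_fat : fat_section sigma Sigma) :
  let S : set V := [set` Sigma] in
  let pi_Sigma : V -> V := orthoproj dot Sigma in
  [/\ forall F : set V, fibers sigma F ->
        [/\ convex_hull F `&` S = pi_Sigma @` convex_hull F,
            pi_Sigma @` convex_hull F = convex_hull (F `&` S)
          & pi_Sigma @` F `<=` convex_hull (F `&` S)],
      forall K : set V, saturated sigma K -> convex_set K ->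
        pi_Sigma @` K = K `&` S
    & set_bij [set K : set V | saturated sigma K /\ convex_set K]
        [set L : set V | saturated_on S sigma L /\ convex_set L]
        (fun K : set V => pi_Sigma @` K)].
Proof.
move=> S pi; have piE := orthoproj_saturated_convex sigma_submetry fiber0 Sigma_fat.
split=> [F [x FE]|//|].
  have piF : pi @` F `<=` convex_hull (F `&` S).
    move=> _ [f Ff <-];
    have := orthoproj_fiber_hull sigma_submetry fiber0 Sigma_fat (f := f).
    apply: convex_hullS => y [yS yf]; split=> //.
    by move: Ff; rewrite FE => -[_ /= fx]; split=> //=; rewrite yf.
  have pi_hull : pi @` convex_hull F `<=` convex_hull (F `&` S).
    move=> _ [f + <-]; move: f.
    apply: (@convex_hull_min _ _ F (pi @^-1` convex_hull (F `&` S))).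
      by apply: convex_preimage; exact: convex_hull_convex.
    by move=> y Fy; apply: piF; exists y.
  have hullF : convex_hull (F `&` S) `<=` convex_hull F.
    by apply: convex_hullS; exact: subIsetl.
  have hullS : convex_hull (F `&` S) `<=` S.
    by apply: convex_hull_min; [exact: convex_vspace|exact: subIsetr].
  have hull_pi : convex_hull F `&` S `<=` pi @` convex_hull F.
    by move=> y [Fy yS]; exists y => //; exact: orthoproj_id.
  split=> //; apply/seteqP; split=> // y.
  - by move=> /pi_hull y_; split; [exact: hullF|exact: hullS].
  - by move=> y_; apply: hull_pi; split; [exact: hullF|exact: hullS].
split.
- move=> K [sK cK] /=; rewrite piE//; split.
    have /saturated_onP[_ Kf] := sK; apply/saturated_onP; split=> [y []//|].
    by move=> y z [Ky _] zS zy; split=> //; exact: Kf Ky _ zy.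
  apply/convex_setP => x y t t01 [Kx Sx] [Ky Sy]; split.
    by apply: (convex_setP K).1.
  by apply: (convex_setP S).1 => //; exact: convex_vspace.
- move=> K K' /set_mem[sK cK] /set_mem[sK' cK'] /=; rewrite !piE// => KK'.
  have sub (A B : set V) : saturated sigma A -> saturated sigma B ->
      A `&` S `<=` B `&` S -> A `<=` B.
    move=> /saturated_onP[_ Af] /saturated_onP[_ Bf] AB y Ay.
    have [z [zS zy] _] := fiber_support sigma_submetry fiber0 y Sigma_fat (mem0v Sigma).
    have [Bz _] : (B `&` S) z by apply: AB; split=> //; exact: Af Ay _ zy.
    by apply: Bf Bz _ _ => //; rewrite zy.
  by apply/seteqP; split; apply: sub; rewrite ?KK'.
- move=> L [sL cL]; have /saturated_onP[LS Lf] := sL.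
  pose K : set V := sigma @^-1` (sigma @` L).
  have sK : saturated sigma K.
    by apply/saturated_onP; split=> // y z [l Ll ly] _ zy; exists l => //; rewrite ly.
  have cK : convex_set K by exact: (saturation_convex sigma_submetry fiber0 Sigma_fat).
  exists K => //=; rewrite piE//; apply/seteqP; split=> y.
    by move=> [[l Ll ly] yS]; exact: Lf Ll yS _.
  by move=> Ly; split; [exists y|exact: LS].
Qed.
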